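(* Let $\varepsilon \in \{-1,1\}$, $\lambda = (\lambda_1,\dots,\lambda_\ell)\in\mathbb{Z}_{>0}^\ell$, $d=\lambda_1+\dots+\lambda_\ell$, $s(j)=\lambda_1+\dots+\lambda_{j-1}$. For $\boldsymbol{n}\in\mathbb{Z}^d$ and $k \in \mathbb{Z}$ let $$A_\lambda(\boldsymbol{n};k)=\prod_{j=1}^{\ell} \binom{n_{s(j)+1}+\dots+n_{s(j)+\lambda_j} - (\lambda_j-1)k}{n_{s(j)+1}-k,\ \dots,\ n_{s(j)+\lambda_j}-k,\ k}, \qquad A_{\lambda,\varepsilon}(\boldsymbol{n}) = \sum_{k\in\mathbb{Z}} \varepsilon^k A_\lambda(\boldsymbol{n};k),$$ and suppose $\boldsymbol{n} \in \mathbb{Z}^d$ is such that this sum has only finitely many nonzero terms for $\boldsymbol{n}$ (and hence for every $m\boldsymbol{n}$, $m\ge1$ considered below, the finiteness being assumed for $p^r\boldsymbol n$ and $p^{r-1}\boldsymbol n$). (a) If $\ell \ge 2$, then for all primes $p \ge 3$ and integers $r\ge1$, $A_{\lambda,\varepsilon}(p^r\boldsymbol{n}) \equiv A_{\lambda,\varepsilon}(p^{r-1}\boldsymbol{n}) \pmod{p^{2r}}$. If $\varepsilon=1$, this also holds for $p=2$. (b) If $\ell\ge2$ and $\max(\lambda_1,\dots,\lambda_\ell)\le 2$, then for all primes $p\ge5$ and integers $r\ge1$, $A_{\lambda,\varepsilon}(p^r\boldsymbol{n}) \equiv A_{\lambda,\varepsilon}(p^{r-1}\boldsymbol{n}) 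\pmod{p^{3r}}$.
   Context: For all integers $n, k$, the binomial coefficient is defined by $\binom{n}{k} = \lim_{z \to 0} \frac{\Gamma(z+n+1)}{\Gamma(z+k+1)\Gamma(z+n-k+1)}$; this is a finite integer for all $n,k\in\mathbb{Z}$, agrees with the usual one for $n\ge0$, and satisfies $\binom{n}{k}=\binom{n}{n-k}$. For integers $m_1,\dots,m_\rho,k$ the multinomial coefficient with integer entries is defined as the product of such binomial coefficients $$\binom{m_1+\dots+m_\rho-(\rho-1)k}{m_1-k,\dots,m_\rho-k,k} := \prod_{i=1}^{\rho}\binom{m_1+\dots+m_i-(i-1)k}{m_i-k},$$ which agrees with the usual multinomial coefficient when all entries are nonnegative (the $i=1$ factor is $\binom{m_1}{k}$; for $\rho=2$ the product is $\binom{m_1}{k}\binom{m_1+m_2-k}{m_1}$). For $\boldsymbol n\in\mathbb{Z}_{\ge0}^d$, $A_{\lambda,\varepsilon}(\boldsymbol n)$ is the coefficient of $x_1^{n_1}\cdots x_d^{n_d}$ in $\big(\prod_{j=1}^\ell[1-\sum_{r=1}^{\lambda_j}x_{s(j)+r}]-\varepsilon x_1\cdots x_d\big)^{-1}$. *)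

(* Defs.v *)
From HB Require Import structures.
From mathcomp Require Import all_boot all_order all_algebra.
Set Implicit Arguments. Unset Strict Implicit. Unset Printing Implicit Defensive.
Import Order.TTheory GRing.Theory Num.Theory.
Local Open Scope ring_scope.

(* Binomial coefficient for all integers n, k, i.e. the value of
   lim_{z->0} Gamma(z+n+1)/(Gamma(z+k+1) Gamma(z+n-k+1)), written in closed form:
   - n >= 0 : usual binomial (0 unless 0 <= k <= n);
   - n < 0, k >= 0 : (-1)^k C(k-n-1, k);
   - n < 0, k <= n : (-1)^(n-k) C(-k-1, n-k);
   - n < k < 0 : 0. *)
Definition gbinom (n k : int) : int :=
  if 0 <= n then
    (if (0 <= k) && (k <= n) then ('C((absz (n)%R), (absz (k)%R)))%:Z else 0)
  else if 0 <= k then (-1) ^+ (absz (k)%R) * ('C((absz (k - n - 1)%R), (absz (k)%R)))%:Z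
  else if k <= n then (-1) ^+ (absz (n - k)%R) * ('C((absz (- k - 1)%R), (absz (n - k)%R)))%:Z
  else 0.

(* Multinomial with integer entries:
   binom(m_1+..+m_rho-(rho-1)k; m_1-k,..,m_rho-k,k)
     := prod_{i=1}^{rho} binom(m_1+..+m_i-(i-1)k, m_i-k)   (0-indexed below). *)
Definition multinom (ms : seq int) (k : int) : int :=
  \prod_(i < size ms) gbinom (\sum_(t < i.+1) ms`_t - (i%:Z) * k) (ms`_i - k).

Definition sfun (lam : seq nat) (j : nat) : nat := sumn (take j lam).
Definition block (lam : seq nat) (n : seq int) (j : nat) : seq int :=
  take (nth 0%N lam j) (drop (sfun lam j) n).

Definition Alam (lam : seq nat) (n : seq int) (k : int) : int :=
  \prod_(j < size lam) multinom (block lam n j) k.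

(* The term eps^k A_lambda(n;k) (eps^k with k : int, eps = +-1 a unit of int). *)
Definition Aterm (lam : seq nat) (eps : int) (n : seq int) (k : int) : int :=
  eps ^ k * Alam lam n k.

Definition Asum (lam : seq nat) (eps : int) (n : seq int) (s : int) : Prop :=
  exists K : nat,
    (forall k : int, (K%:Z < `|k|)%R -> Aterm lam eps n k = 0) /\
    s = \sum_(i < (K.*2).+1) Aterm lam eps n (i%:Z - K%:Z).

Definition scalev (m : nat) (n : seq int) : seq int := map (fun x => x * m%:Z) n.

(* Main.v *)
Require Import Defs.
From HB Require Import structures.
From mathcomp Require Import all_boot all_order all_algebra.
From mathcomp Require Import zify ring.
Import Order.TTheory GRing.Theory Num.Theory.
Local Open Scope ring_scope.

(** Write [q = p^r] and split the sum over [k] at [p^r n] according to whether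
    [p] divides [k].

    Terms [k = p k'] are compared with the terms [k'] at [p^(r-1) n].  The
    quotient [gbinom (pA) (pB) / gbinom A B] is [U(pA) / U(pB)], where [U(x)] is
    the product of the [x - i] over [0 <= i < N = pB] prime to [p].  Pairing [i]
    with [N - i] shows that [U(x)] only depends on [x (x - N)], whence Jacobsthal
    type congruences; for [p >= 5] the vanishing of the sum of the inverse squares
    gains one more factor.  If [s < r] is the valuation of [k], the coefficients
    [gbinom (n_{s(j)+1}) k] of two blocks contribute the missing [p^(2(r-s))].

    Terms with [k] prime to [p] are divisible by [q^l], [l] the number of blocks.
    For (b) with [l = 2],
    such a term is [q^2 eps^k / k^2] times a function [G] of [k] with
    [G (k+1) = G k] mod [p^(r - v)], [v] the valuation of [k], and the sum over a
    block of length [q] vanishes mod [q^3] since the sums of [eps^k / k^2] over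
    blocks of length [p^j] vanish mod [p^j]. *)

(** * Binomial coefficients with integer entries *)

Lemma gbinom0 (n k : int) : k < 0 -> n < k -> gbinom n k = 0.
Proof.
move=> k0 nk; rewrite /gbinom.
have -> : (0 <= n) = false by lia.
have -> : (0 <= k) = false by lia.
by have -> : (k <= n) = false by lia.
Qed.

Lemma gbinom_small (n k : int) : 0 <= n -> (k < 0) || (n < k) -> gbinom n k = 0.
Proof.
by move=> n0 nk; rewrite /gbinom n0; have -> : (0 <= k) && (k <= n) = false by lia.
Qed.

Lemma gbinom_sym (n k : int) : gbinom n k = gbinom n (n - k).
Proof.
rewrite /gbinom.
have [n0|n0] := leP 0 n.
  have -> : (0 <= n - k) && (n - k <= n) = (0 <= k) && (k <= n) by lia.
  case: ifP => // /andP[k0 kn].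
  have -> : `|n - k|%N = (`|n| - `|k|)%N by lia.
  by rewrite bin_sub //; lia.
have [k0|k0] := leP 0 k.
  have -> : (0 <= n - k) = false by lia.
  have -> : n - k <= n by lia.
  by congr ((-1) ^+ _ * ('C(_, _))%:Z); lia.
have -> : (0 <= n - k) = (k <= n) by lia.
have -> : n - k <= n = false by lia.
case: ifP => // kn.
by congr ((-1) ^+ _ * ('C(_, _))%:Z); lia.
Qed.

(** For a nonnegative lower entry the limit of Gamma quotients is the falling factorial of [n] over
    [k!], whatever the sign of [n]. Multiplied out, it turns later identities into identities of
    integer products. *)
Lemma gbinom_fact (n : int) (k : nat) :
  (k`!)%:Z * gbinom n k = \prod_(0 <= i < k) (n - i%:Z).
Proof.
have Cpos (m l : nat) : (l`!)%:Z * ('C(m, l))%:Z = \prod_(0 <= i < l) (m%:Z - i%:Z).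
  elim: l => [|l IH]; first by rewrite big_nil bin0.
  rewrite big_nat_recr //= -IH factS mulrC.
  have [lm|lm] := leqP l m; last by rewrite !bin_small ?(mulr0, mul0r) //; lia.
  have := mul_bin_left m l; set c := 'C(m, l.+1); set c' := 'C(m, l) => H.
  have {}H : l.+1%:Z * c%:Z = (m%:Z - l%:Z) * c'%:Z by rewrite -PoszM H PoszM; congr (_ * _); lia.
  transitivity ((l`!)%:Z * (l.+1%:Z * c%:Z)); first by rewrite PoszM; ring.
  by rewrite H; ring.
case: n => m; first rewrite -(Cpos m k) /gbinom /=.
  congr (_ * _).
  by case: ifP => // /negbT km; rewrite bin_small //; lia.
rewrite /gbinom /=.
have -> : absz (k%:Z - Negz m - 1)%R = (m + k)%N by lia.
elim: k => [|k IH]; first by rewrite big_nil bin0.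
rewrite big_nat_recr //= -IH factS exprS addnS.
have := mul_bin_diag (m + k).+1 k; rewrite succnK.
rewrite NegzE; set c := 'C(_, k); set c' := 'C(_, k.+1); set e := _ ^+ k; set f := k`!.
rewrite !PoszM => H.
have {}H : (m + k)%N.+1%:Z * c%:Z = k.+1%:Z * c'%:Z by rewrite -!PoszM H.
transitivity (- (f%:Z * e * (k.+1%:Z * c'%:Z))); first by ring.
by rewrite -H -!natz -!natr1 !natz PoszD; ring.
Qed.

(** For [k >= 0], both sides times [k!] are the product of [n - i] over [0 <= i <= k]. *)
Lemma mul_gbinom_left (n k : int) : n * gbinom (n - 1) k = (n - k) * gbinom n k.
Proof.
have [k0|k0] := leP 0 k.
  case: k k0 => // k _; have kf : (k`!)%:Z != 0 by have := fact_gt0 k; lia.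
  apply: (mulfI kf); rewrite mulrCA gbinom_fact mulrCA gbinom_fact.
  rewrite mulrC (mulrC (n - _)) -(@big_nat_recr _ _ _ k 0 (fun i => n - i%:Z)) //.
  rewrite big_nat_recl // mulrC subr0; congr (_ * _).
  by apply: eq_big_nat => i _; lia.
have [nk|nk] := ltP n k; first by rewrite !gbinom0 ?mulr0 //; lia.
have [n0|n0] := ltP 0 n; first by rewrite !gbinom_small ?mulr0 //; lia.
have [->|n1] := eqVneq n 0; first by rewrite mul0r gbinom_small ?mulr0 //; lia.
(* Only [k <= n < 0] is left. By symmetry the lower entries become [l] and [l - 1] with
   [l = n - k >= 0], and falling factorials apply again. *)
rewrite (gbinom_sym n) (gbinom_sym (n - 1)).
move: nk; have [l ->] : exists l : int, k = n - l by exists (n - k); lia.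
have -> : n - 1 - (n - l) = l - 1 by lia.
have -> : n - (n - l) = l by lia.
move=> l0; have {l0} : 0 <= l by lia.
case: l => // -[_|l _]; first by rewrite mul0r gbinom0 ?mulr0; lia.
have -> : Posz l.+1 - 1 = l by lia.
have kf : (l`!)%:Z != 0 by have := fact_gt0 l; lia.
apply: (mulfI kf); rewrite mulrCA gbinom_fact mulrA -PoszM -(mulnC l.+1) -factS gbinom_fact.
rewrite big_nat_recl // subr0; congr (_ * _).
by apply: eq_big_nat => i _; lia.
Qed.

Lemma mul_gbinom_diag (n k : int) : k * gbinom n k = n * gbinom (n - 1) (k - 1).
Proof.
rewrite (gbinom_sym (n - 1)) (gbinom_sym n).
have -> : n - 1 - (k - 1) = n - k by lia.
by rewrite mul_gbinom_left; congr (_ * _); lia.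
Qed.

Lemma mul_gbinom_down (n k : int) : k * gbinom n k = (n - k + 1) * gbinom n (k - 1).
Proof. by rewrite mul_gbinom_diag mul_gbinom_left; congr (_ * _); lia. Qed.

(* The reflection [binom n k = (-1)^k binom (k-n-1) k], multiplied out so that
   only multiples of [p] occur as entries when [n] and [k] are multiples of [p]. *)
Lemma gbinom_reflect (n : int) (k : nat) :
  (n - k%:Z) * gbinom n k = (-1) ^+ k * n * gbinom (k%:Z - n) k.
Proof.
have kf : (k`!)%:Z != 0 by have := fact_gt0 k; lia.
apply: (mulfI kf); rewrite mulrCA gbinom_fact mulrCA gbinom_fact.
rewrite mulrC -(@big_nat_recr _ _ _ k 0 (fun i => n - i%:Z)) // big_nat_recl //.
rewrite subr0 (mulrC _ n) -mulrA; congr (_ * _).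
rewrite [X in _ = _ * X]big_nat_rev /=.
have -> : (-1) ^+ k = \prod_(0 <= i < k) (-1) :> int by rewrite prodr_const_nat subn0.
rewrite -big_split /=; apply: eq_big_nat => i ik.
by rewrite add0n; lia.
Qed.

(** * Splitting and pairing of indices; divisibility of sums and products *)

Lemma big_nat_mulID (R : Type) (idx : R) (op : Monoid.com_law idx) (p B : nat)
    (F : nat -> R) : (0 < p)%N ->
  \big[op/idx]_(0 <= i < p * B) F i =
  op (\big[op/idx]_(0 <= i < B) F (p * i)%N)
     (\big[op/idx]_(0 <= i < p * B | ~~ (p %| i)%N) F i).
Proof.
move=> p0; rewrite (bigID (fun i => (p %| i)%N)) /=; congr (op _ _).
elim: B => [|B IH]; first by rewrite muln0 !big_nil.
rewrite big_nat_recr //= -IH (@big_cat_nat _ _ _ (p * B)) //=; last by rewrite leq_mul2l leqnSn orbT.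
congr (op _ _); rewrite big_ltn_cond ?ltn_pmul2l // dvdn_mulr // big_nat_cond big_pred0 ?Monoid.mulm1 // => i.
apply/negP => /andP[/andP[h1 h2] /dvdnP[k ik]].
move: h1 h2; rewrite ik (mulnC k) !ltn_pmul2l //; lia.
Qed.

(** As [p] divides [N], the involution [i -> N - i] preserves the indices not divisible by [p]. The
    second hypothesis excludes its fixed point [N / 2]. *)
Lemma big_nat_halve (R : Type) (idx : R) (op : Monoid.com_law idx) (p N : nat)
    (F : nat -> R) : (p %| N)%N ->
  (forall i, ~~ (p %| i)%N -> i.*2 != N) ->
  \big[op/idx]_(0 <= i < N | ~~ (p %| i)%N) F i =
  \big[op/idx]_(0 <= i < N | ~~ (p %| i)%N && (i.*2 < N)%N) op (F i) (F (N - i)%N).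
Proof.
move=> pN mid; case: (posnP N) => [->|N0]; first by rewrite !big_nil.
rewrite big_ltn_cond // [RHS]big_ltn_cond // dvdn0 /= (bigID (fun i => (i.*2 < N)%N)) /= big_split /=.
congr (op _ _); rewrite big_nat_rev /= big_nat_cond [RHS]big_nat_cond.
apply: eq_big => [i|i /andP[/andP[h1 h2] _]]; last by congr F; lia.
case: (boolP (1 <= i < N)%N) => //= /andP[i0 iN].
have -> : (1 + N - i.+1 = N - i)%N by lia.
rewrite dvdn_subr //; last by lia.
case: (boolP (p %| i)%N) => //= /mid; lia.
Qed.

Lemma dvdz_subM (d a b a' b' : int) :
  (d %| a - b)%Z -> (d %| a' - b')%Z -> (d %| a * a' - b * b')%Z.
Proof.
move=> h h'; have -> : a * a' - b * b' = (a - b) * a' + b * (a' - b') by ring.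
by apply: rpredD; [exact: dvdz_mulr | exact: dvdz_mull].
Qed.

Lemma dvdz_sub_prod (I : Type) (s : seq I) (P : pred I) (d : int) (F G : I -> int) :
  (forall i, P i -> (d %| F i - G i)%Z) ->
  (d %| \prod_(i <- s | P i) F i - \prod_(i <- s | P i) G i)%Z.
Proof.
move=> FG; apply: (big_rec2 (fun x y => d %| x - y)%Z); first by rewrite subrr dvdz0.
by move=> i x y Pi; apply: dvdz_subM; apply: FG.
Qed.

Lemma dvdz_sum (I : Type) (s : seq I) (P : pred I) (d : int) (F : I -> int) :
  (forall i, P i -> (d %| F i)%Z) -> (d %| \sum_(i <- s | P i) F i)%Z.
Proof. by move=> dF; apply: rpred_sum. Qed.

Lemma coprimez_prod (I : Type) (s : seq I) (P : pred I) (d : int) (F : I -> int) :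
  (forall i, P i -> coprimez d (F i)) -> coprimez d (\prod_(i <- s | P i) F i).
Proof.
move=> cF; apply: (big_rec (coprimez d)); first by rewrite coprimezE coprimen1.
by move=> i x Pi cx; rewrite coprimezMr cF.
Qed.

Lemma prime_coprimez (p : nat) (x : int) : prime p -> coprimez p%:Z x = ~~ (p%:Z %| x)%Z.
Proof. by move=> pp; rewrite coprimezE prime_coprime. Qed.

(** * Sums of inverse squares over units *)

(* Doubling permutes the units mod [p ^ s], so [4 S = S] for the sum [S] of the
   inverse squares. *)
Lemma dvdz_sum_inv_sqr_block (p s : nat) (w : nat -> int) : prime p -> (5 <= p)%N ->
  (forall i, ~~ (p %| i)%N -> ((p ^ s)%N%:Z %| w i * (i%:Z * i%:Z) - 1)%Z) ->
  ((p ^ s)%N%:Z %| \sum_(0 <= i < p ^ s | ~~ (p %| i)%N) w i)%Z.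
Proof.
move=> pp p5; case: s => [|s]; first by rewrite expn0 dvd1z.
have pP : (p %| p ^ s.+1)%N by rewrite dvdn_exp.
have oP : odd (p ^ s.+1) by rewrite oddX; case: (even_prime pp) => [p2|->]; [lia|rewrite orbT].
(* From [4 S = S] follows [3 S = 0], and 3 is invertible since [p >= 5]. *)
have cP : coprimez (p ^ s.+1)%N%:Z 3.
  rewrite coprimezE coprimeXl // prime_coprime //; apply/negP => /dvdn_leq => /(_ isT); lia.
set P := (p ^ s.+1)%N in pP oP cP *; move=> wP.
have hlt (i : 'I_P) : ((if (i.*2 < P)%N then i.*2 else i.*2 - P)%N < P)%N.
  by have := ltn_ord i; case: ifP; lia.
pose h i : 'I_P := Ordinal (hlt i).
have hinj : injective h.
  move=> i j /(congr1 val) /= hij; apply: val_inj => /=.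
  by move: hij (ltn_ord i) (ltn_ord j); do 2 case: ifP; lia.
have hp (i : 'I_P) : (p %| h i)%N = (p %| i)%N.
  have p2 : (p %| i.*2)%N = (p %| i)%N.
    rewrite -mul2n Gauss_dvdr // prime_coprime //; apply/negP => /dvdn_leq => /(_ isT); lia.
  by rewrite /=; case: ifP => // /negbT; rewrite -leqNgt => h2; rewrite dvdn_subl.
rewrite -(Gauss_dvdzr _ cP) big_mkord; set S := \sum_(i < P | _) _.
have -> : 3 * S = \sum_(i < P | ~~ (p %| i)%N) (4 * w (h i) - w i).
  rewrite sumrB -mulr_sumr; have -> : \sum_(i < P | ~~ (p %| i)%N) w (h i) = S.
    by rewrite /S [RHS](reindex_inj hinj); apply: eq_bigl => i; rewrite hp.
  by rewrite -/S; ring.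
apply: dvdz_sum => i pi.
have wi := wP _ pi; have whi : (P%:Z %| w (h i) * ((h i)%:Z * (h i)%:Z) - 1)%Z by apply: wP; rewrite hp.
have [e he] : exists e : int, (h i)%:Z = 2 * i%:Z - e * P%:Z.
  by rewrite /=; case: ifP => hi; [exists 0 | exists 1]; lia.
have {whi} whi : (P%:Z %| w (h i) * (4 * (i%:Z * i%:Z)) - 1)%Z.
  have -> : w (h i) * (4 * (i%:Z * i%:Z)) - 1 = w (h i) * ((h i)%:Z * (h i)%:Z) - 1
    + w (h i) * (4 * i%:Z * e - e * e * P%:Z) * P%:Z by rewrite he; ring.
  by rewrite rpredD // dvdz_mull.
(* Both [4 * w (h i)] and [w i] are inverses of [i^2] modulo [P], hence congruent. *)
have -> : 4 * w (h i) - w i = w i * (w (h i) * (4 * (i%:Z * i%:Z)) - 1)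
  - 4 * w (h i) * (w i * (i%:Z * i%:Z) - 1) by ring.
by rewrite rpredB // dvdz_mull.
Qed.

(** Cut into periods of length [p^s]; the shifted weight still inverts [i^2] modulo [p^s], so each
    period vanishes. *)
Lemma dvdz_sum_inv_sqr (p s N : nat) (w : nat -> int) : prime p -> (5 <= p)%N ->
  (p ^ s %| N)%N ->
  (forall i, ~~ (p %| i)%N -> ((p ^ s)%N%:Z %| w i * (i%:Z * i%:Z) - 1)%Z) ->
  ((p ^ s)%N%:Z %| \sum_(0 <= i < N | ~~ (p %| i)%N) w i)%Z.
Proof.
move=> pp p5; case: s => [|s]; first by rewrite expn0 !dvd1z.
set P := (p ^ s.+1)%N => /dvdnP[m ->] wP.
have P0 : (0 < P)%N by rewrite expn_gt0 prime_gt0.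
elim: m => [|m IH]; first by rewrite mul0n big_nil dvdz0.
rewrite (@big_cat_nat _ _ _ (m * P)) //=; last by rewrite leq_mul2r leqnSn orbT.
rewrite rpredD // -{1}(add0n (m * P)%N) big_addn mulSn addnK.
have pmP : (p %| m * P)%N by rewrite dvdn_mull // dvdn_exp.
under eq_bigl => i do rewrite dvdn_addl //.
apply: dvdz_sum_inv_sqr_block => // i pi.
have /wP : ~~ (p %| i + m * P)%N by rewrite dvdn_addl.
rewrite -/P => wi.
have -> : w (i + m * P)%N * (i%:Z * i%:Z) - 1 =
  w (i + m * P)%N * ((i + m * P)%N%:Z * (i + m * P)%N%:Z) - 1
  - w (i + m * P)%N * (2 * i%:Z + m%:Z * P%:Z) * m%:Z * P%:Z by rewrite PoszD PoszM; ring.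
by rewrite rpredB // dvdz_mull.
Qed.

(** As [p^s] is odd, [i] and [p^s - i] have opposite parity, so their terms cancel. *)
Lemma dvdz_sum_alt_inv_sqr (p s : nat) (w : nat -> int) : prime p -> odd p ->
  (forall i, ~~ (p %| i)%N -> ((p ^ s)%N%:Z %| w i * (i%:Z * i%:Z) - (-1) ^+ i)%Z) ->
  ((p ^ s)%N%:Z %| \sum_(0 <= i < p ^ s | ~~ (p %| i)%N) w i)%Z.
Proof.
move=> pp op; case: s => [|s]; first by rewrite expn0 dvd1z.
have pP : (p %| p ^ s.+1)%N by rewrite dvdn_exp.
have oP : odd (p ^ s.+1) by rewrite oddX op orbT.
have cPi (i : nat) : ~~ (p %| i)%N -> coprimez (p ^ s.+1)%N%:Z (i%:Z * i%:Z).
  by move=> pi; rewrite coprimezMr andbb coprimezE coprimeXl // prime_coprime.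
set P := (p ^ s.+1)%N in pP oP cPi *; move=> wP.
rewrite big_nat_halve //; last by move=> i _; apply/negP => /eqP e; rewrite -e odd_double in oP.
rewrite big_nat_cond; apply: dvdz_sum => i /andP[_ /andP[pi iP]].
have iP' : (i <= P)%N by lia.
have pPi : ~~ (p %| P - i)%N by rewrite dvdn_subr.
rewrite -(Gauss_dvdzl _ (cPi _ pi)).
have := rpredD (wP _ pi) (wP _ pPi).
rewrite -signr_odd -(signr_odd _ (P - i)) oddB // oP /=.
have -> : (P - i)%N%:Z = P%:Z - i%:Z by lia.
set e := (-1) ^+ odd i; have -> : (-1) ^+ (~~ odd i) = - e :> int by rewrite signrN.
set a := w i; set b := w _ => h.
have -> : (a + b) * (i%:Z * i%:Z) = (a * (i%:Z * i%:Z) - e + (b * ((P%:Z - i%:Z) * (P%:Z - i%:Z)) - - e))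
  - b * (P%:Z - 2 * i%:Z) * P%:Z by ring.
by rewrite rpredB // dvdz_mull.
Qed.

(** * Jacobsthal congruences *)

(** The [U(x)] of the overview. When [p] divides [N], its value at [x = N] is the product of the
    integers up to [N] not divisible by [p]. *)
Definition unit_prod (p N : nat) (x : int) : int :=
  \prod_(0 <= i < N | ~~ (p %| i)%N) (x - i%:Z).

(** In the falling factorial of length [pB] at [pA], the multiples of [p] contribute [p^B * B!]
    times the smaller binomial; the other factors form [U(pA)]. *)
Lemma gbinom_scale (p B : nat) (A : int) : (0 < p)%N ->
  gbinom (p%:Z * A) (p * B)%N%:Z * unit_prod p (p * B) (p * B)%N%:Z =
  gbinom A B%:Z * unit_prod p (p * B) (p%:Z * A).
Proof.
move=> p0.
have key (C : int) : ((p * B)`!)%:Z * gbinom (p%:Z * C) (p * B)%N%:Z =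
    p%:Z ^+ B * (B`!)%:Z * gbinom C B%:Z * unit_prod p (p * B) (p%:Z * C).
  rewrite gbinom_fact big_nat_mulID // -(mulrA (_ ^+ _)) gbinom_fact.
  rewrite (_ : p%:Z ^+ B = \prod_(0 <= i < B) p%:Z); last by rewrite prodr_const_nat subn0.
  rewrite -big_split; congr (_ * _); apply: eq_bigr => i _ /=; rewrite PoszM; ring.
have gnn (m : nat) : gbinom m%:Z m%:Z = 1 by rewrite /gbinom /= lexx binn.
(* At [C = B] both binomials are 1, which evaluates [(pB)!]. *)
have := key B%:Z; rewrite -PoszM !gnn !mulr1 => kB.
have := key A; rewrite kB => kA.
have c0 : p%:Z ^+ B * (B`!)%:Z != 0.
  by rewrite mulf_neq0 ?expf_neq0 //; [lia | have := fact_gt0 B; lia].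
by apply: (mulfI c0); rewrite (mulrA _ (gbinom A _)) -kA; ring.
Qed.

Lemma coprimez_unit_prod (p N : nat) : prime p -> (p %| N)%N ->
  coprimez p%:Z (unit_prod p N N%:Z).
Proof.
move=> pp pN; rewrite /unit_prod big_nat_cond; apply: coprimez_prod => i /andP[/andP[_ iN] pi].
have -> : N%:Z - i%:Z = (N - i)%N%:Z by lia.
by rewrite prime_coprimez // dvdzE /= dvdn_subr // ltnW.
Qed.

(** The factors at [i] and [N - i] multiply to [x (x - N) + i (N - i)]. The condition on [p] and [N]
    forces a midpoint [N / 2] to be a multiple of [p]. *)
Lemma unit_prod_halve (p N : nat) (x : int) : prime p -> (p %| N)%N ->
  odd p || (2 * p %| N)%N ->
  unit_prod p N x = \prod_(0 <= i < N | ~~ (p %| i)%N && (i.*2 < N)%N)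
    (x * (x - N%:Z) + i%:Z * (N - i)%N%:Z).
Proof.
move=> pp pN odp; rewrite /unit_prod big_nat_halve //.
  by apply: eq_bigr => i /andP[_ iN] /=; have -> : (N - i)%N%:Z = N%:Z - i%:Z by [lia|]; ring.
move=> i pi; apply: contra pi => /eqP iN; move: odp => /orP[op|].
  by move: pN; rewrite -iN -mul2n Gauss_dvdr // coprimen2.
by rewrite -iN -mul2n dvdn_pmul2l.
Qed.

Lemma dvdz_unit_prod_sub (p N : nat) (x d : int) : prime p -> (p %| N)%N ->
  odd p || (2 * p %| N)%N -> (d %| x * (x - N%:Z))%Z ->
  (d %| unit_prod p N x - unit_prod p N N%:Z)%Z.
Proof.
move=> pp pN odp dx; rewrite !unit_prod_halve //; apply: dvdz_sub_prod => i _.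
by rewrite subrr mulr0 add0r addrK.
Qed.

Definition invz_mod (x d : int) : int := (egcdz x d).1.

Lemma invz_modP (x d : int) : coprimez d x -> (d %| invz_mod x d * x - 1)%Z.
Proof.
rewrite coprimez_sym /invz_mod => /eqP cdx; case: egcdzP => u v /= uv _.
have -> : u * x - 1 = - v * d by rewrite -cdx -uv; ring.
exact: dvdz_mull.
Qed.

Lemma prod_one_sub_mul (I : Type) (s : seq I) (P : pred I) (y : int) (w : I -> int) :
  (y * y %| \prod_(i <- s | P i) (1 - y * w i) - (1 - y * \sum_(i <- s | P i) w i))%Z.
Proof.
apply: (big_rec2 (fun a b => y * y %| a - (1 - y * b))%Z); first by rewrite mulr0 subr0 subrr dvdz0.
move=> i b a _ h.
have -> : (1 - y * w i) * b - (1 - y * (w i + a)) =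
  (1 - y * w i) * (b - (1 - y * a)) + w i * a * (y * y) by ring.
by apply: rpredD; rewrite dvdz_mull.
Qed.

(** With [y = x (x - N)], and [i (N - i)] congruent to [-i^2] mod [p^s], the paired factor is
    [i (N - i) (1 - y / i^2)] mod [p^(t+s)]. Since [s <= t], the terms in [y^2] drop out; the linear
    term is [y] times a half sum of inverse squares, which vanishes mod [p^s]. *)
Lemma dvdz_unit_prod_sub_ge5 (p s t N : nat) (x : int) : prime p -> (5 <= p)%N ->
  (p %| N)%N -> (p ^ s %| N)%N -> (s <= t)%N ->
  ((p ^ t)%N%:Z %| x * (x - N%:Z))%Z ->
  ((p ^ (t + s))%N%:Z %| unit_prod p N x - unit_prod p N N%:Z)%Z.
Proof.
move=> pp p5 pN psN st yt.
have op : odd p by case: (even_prime pp) => // p2; move: p5; rewrite p2.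
have cop (i : nat) : ~~ (p %| i)%N -> coprimez (p ^ s)%N%:Z (i%:Z * i%:Z).
  by move=> pi; rewrite coprimezMr andbb coprimezE coprimeXl // prime_coprime.
pose w (i : nat) := invz_mod (i%:Z * i%:Z) (p ^ s)%N%:Z.
have wP i : ~~ (p %| i)%N -> ((p ^ s)%N%:Z %| w i * (i%:Z * i%:Z) - 1)%Z.
  by move=> /cop /invz_modP.
have [M NM] : exists M : int, N%:Z = M * (p ^ s)%N%:Z.
  by case/dvdnP: psN => m ->; exists m%:Z; rewrite PoszM.
have Sw : ((p ^ s)%N%:Z %| \sum_(0 <= i < N | ~~ (p %| i)%N && (i.*2 < N)%N) w i)%Z.
  have c2 : coprimez (p ^ s)%N%:Z 2.
    rewrite coprimezE coprimeXl // prime_coprime //.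
    by apply/negP => /dvdn_leq => /(_ isT); rewrite leqNgt; case: (p) p5 => [|[|[]]].
  (* As [w (N - i)] is congruent to [w i], the full sum is twice the half sum, and 2 is
     invertible. *)
  have := dvdz_sum_inv_sqr _ _ _ _ pp p5 psN wP.
  rewrite big_nat_halve //; last first.
    move=> i pi; apply: contra pi => /eqP iN; move: pN.
    by rewrite -iN -mul2n Gauss_dvdr // coprimen2.
  set S := \sum_(_ <= i < _ | _) _ => dS.
  rewrite -(Gauss_dvdzr _ c2) mulr_sumr -[X in (_ %| X)%Z](subrK S) rpredD // /S -sumrB.
  rewrite big_nat_cond; apply: dvdz_sum => i /andP[_ /andP[pi iN]] /=.
  have pNi : ~~ (p %| N - i)%N by rewrite dvdn_subr //; lia.
  rewrite -(Gauss_dvdzl _ (cop _ pi)).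
  have := wP _ pNi; have -> : (N - i)%N%:Z = N%:Z - i%:Z by lia.
  set a := w i; set b := w _ => h.
  have -> : (2 * a - (a + b)) * (i%:Z * i%:Z) = (a * (i%:Z * i%:Z) - 1)
     - (b * ((N%:Z - i%:Z) * (N%:Z - i%:Z)) - 1) + b * (N%:Z - 2 * i%:Z) * M * (p ^ s)%N%:Z.
    by rewrite -mulrA -NM; ring.
  by apply: rpredD; [apply: rpredB => //; apply: wP | apply: dvdz_mull].
rewrite !unit_prod_halve ?op //.
rewrite [X in (_ %| _ - X)%Z](eq_bigr (fun i : nat => i%:Z * (N - i)%N%:Z)); last first.
  by move=> i _; rewrite subrr mulr0 add0r.
set y := x * (x - N%:Z) in yt *.
set e := fun i : nat => i%:Z * (N - i)%N%:Z.
set R := \prod_(_ <= i < _ | _) e i.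
set T := \sum_(_ <= i < _ | _) _ in Sw.
set Q := \prod_(0 <= i < N | ~~ (p %| i)%N && (i.*2 < N)%N) (1 - y * w i).
have h1 : ((p ^ (t + s))%N%:Z %|
    \prod_(0 <= i < N | ~~ (p %| i)%N && (i.*2 < N)%N) (y + e i) - R * Q)%Z.
  rewrite -big_split /= expnD PoszM; apply: dvdz_sub_prod => i /andP[pi iN].
  have -> : y + e i - e i * (1 - y * w i) = y * (1 + e i * w i) by ring.
  apply: dvdz_mul => //.
  have -> : 1 + e i * w i = i%:Z * w i * M * (p ^ s)%N%:Z - (w i * (i%:Z * i%:Z) - 1).
    by rewrite -mulrA -NM /e; have -> : (N - i)%N%:Z = N%:Z - i%:Z by [lia|]; ring.
  by apply: rpredB; [apply: dvdz_mull | apply: wP].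
have h2 : ((p ^ (t + s))%N%:Z %| Q - (1 - y * T))%Z.
  apply: dvdz_trans (prod_one_sub_mul _ _ _ _ _).
  by rewrite expnD PoszM dvdz_mul // (dvdz_trans _ yt) // dvdzE /= dvdn_exp2l.
have h3 : ((p ^ (t + s))%N%:Z %| y * T)%Z by rewrite expnD PoszM dvdz_mul.
rewrite (_ : _ - R = \prod_(0 <= i < N | ~~ (p %| i)%N && (i.*2 < N)%N) (y + e i) - R * Q
  + R * ((Q - (1 - y * T)) - y * T)); last by ring.
by apply: rpredD => //; apply: dvdz_mull; apply: rpredB.
Qed.

(* [x / y = c mod d] as a congruence between p-integral fractions. *)
Definition ratio_mod (p : nat) (d c x y : int) : Prop :=
  exists D E : int, [/\ coprimez p%:Z D, x * D = y * E & (d %| E - c * D)%Z].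

(** The multiplied-out form of [ratio_mod] admits [0 / 0], which occurs when both binomials
    vanish. *)
Lemma ratio_mod00 (p : nat) (d c : int) : ratio_mod p d c 0 0.
Proof. by exists 1, c; rewrite !mul0r mulr1 subrr dvdz0 coprimezE coprimen1. Qed.

Lemma ratio_mod_mul (p : nat) (d c c' x y x' y' : int) :
  ratio_mod p d c x y -> ratio_mod p d c' x' y' -> ratio_mod p d (c * c') (x * x') (y * y').
Proof.
move=> [D [E [cD xD dE]]] [D' [E' [cD' xD' dE']]]; exists (D * D'), (E * E'); split.
- by rewrite coprimezMr cD.
- by rewrite mulrACA xD xD' mulrACA.
- by rewrite mulrACA; apply: dvdz_subM.
Qed.

(** Since [x - y = y (x / y - 1)], the powers of [p] in both factors add up. *)
Lemma ratio_mod_dvdz (p t u : nat) (x y : int) : prime p ->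
  ratio_mod p (p ^ t)%N%:Z 1 x y -> ((p ^ u)%N%:Z %| y)%Z ->
  ((p ^ (u + t))%N%:Z %| x - y)%Z.
Proof.
move=> pp [D [E [cD xD dE]]] uy.
have cD' : coprimez (p ^ (u + t))%N%:Z D by rewrite coprimezE coprimeXl.
rewrite -(Gauss_dvdzl _ cD') mulrBl xD -mulrBr expnD PoszM dvdz_mul //.
by rewrite -(mul1r D).
Qed.

(* By the symmetry [k -> n-k] only nonnegative lower entries matter. *)
Lemma gbinom_scale_ratio (p : nat) (A B d c : int) : prime p ->
  (forall B' : nat, B'%:Z = B \/ B'%:Z = A - B ->
    (d %| unit_prod p (p * B') (p%:Z * A) - c * unit_prod p (p * B') (p * B')%N%:Z)%Z) ->
  ratio_mod p d c (gbinom (p%:Z * A) (p%:Z * B)) (gbinom A B).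
Proof.
move=> pp H; have p0 := prime_gt0 pp.
have main (B' : nat) : B'%:Z = B \/ B'%:Z = A - B ->
    ratio_mod p d c (gbinom (p%:Z * A) (p%:Z * B'%:Z)) (gbinom A B'%:Z).
  move=> hB'; exists (unit_prod p (p * B') (p * B')%N%:Z), (unit_prod p (p * B') (p%:Z * A)).
  by rewrite coprimez_unit_prod ?dvdn_mulr // -PoszM gbinom_scale //; split => //; apply: H.
have [B0|B0] := leP 0 B.
  have [B' hB] : exists B' : nat, B = B' by exists (absz B); lia.
  by rewrite hB; apply: main; left.
have [AB|AB] := leP B A.
  have [B' hB] : exists B' : nat, A - B = B' by exists (absz (A - B)%R); lia.
  by rewrite gbinom_sym (gbinom_sym A) -mulrBr hB; apply: main; right.
rewrite !gbinom0 //; [exact: ratio_mod00 | |]; nia.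
Qed.

(** With [x = pA] and [N = pB'], both [x] and [x - N] are divisible by [p^s]. For [p = 2], [s >= 2]
    gives [4 | N], as the pairing requires. *)
Lemma gbinom_scale_ratio_sqr (p s : nat) (A B : int) : prime p -> (0 < s)%N ->
  odd p || (1 < s)%N ->
  ((p ^ s)%N%:Z %| p%:Z * A)%Z -> ((p ^ s)%N%:Z %| p%:Z * B)%Z ->
  ratio_mod p (p ^ (s + s))%N%:Z 1 (gbinom (p%:Z * A) (p%:Z * B)) (gbinom A B).
Proof.
move=> pp s0 ops pA pB; apply: gbinom_scale_ratio => // B' hB'; rewrite mul1r.
have pB' : ((p ^ s)%N%:Z %| (p * B')%N%:Z)%Z.
  by rewrite PoszM; case: hB' => -> //; rewrite mulrBr rpredB.
apply: dvdz_unit_prod_sub => //; first exact: dvdn_mulr.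
  case: (even_prime pp) ops pB' => [->|-> //] /=.
  by case: s {s0 pA pB} => [|[|s]] // _; apply: dvdn_trans; rewrite (expnD 2 2) dvdn_mulr.
by rewrite expnD [X in (X %| _)%Z]PoszM dvdz_mul // rpredB.
Qed.

(** Here [x = pA] contributes [p^r], [x - N] contributes [p^s], and the inverse squares another
    [p^s]. *)
Lemma gbinom_scale_ratio_cube (p s r : nat) (A B : int) : prime p -> (5 <= p)%N ->
  (s <= r)%N ->
  ((p ^ r)%N%:Z %| p%:Z * A)%Z -> ((p ^ s)%N%:Z %| p%:Z * B)%Z ->
  ratio_mod p (p ^ (r + s + s))%N%:Z 1 (gbinom (p%:Z * A) (p%:Z * B)) (gbinom A B).
Proof.
move=> pp p5 sr pA pB; apply: gbinom_scale_ratio => // B' hB'; rewrite mul1r.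
have psr : ((p ^ s)%N%:Z %| (p ^ r)%N%:Z)%Z by rewrite dvdzE /= dvdn_exp2l.
have pAs := dvdz_trans psr pA.
have pB' : ((p ^ s)%N%:Z %| (p * B')%N%:Z)%Z.
  by rewrite PoszM; case: hB' => -> //; rewrite mulrBr rpredB.
apply: dvdz_unit_prod_sub_ge5 => //; [exact: dvdn_mulr | exact: leq_addl |].
by rewrite expnD [X in (X %| _)%Z]PoszM dvdz_mul // rpredB.
Qed.

(* Here the larger power of [p] divides [A - B].  For [B < 0 <= A - B] and
   [A < 0] the symmetry would put [A - B] below, which is useless, so we
   reflect to [gbinom (- B) (- A)]. *)
Lemma gbinom_scale_ratio_cube_sub (p s r : nat) (A B : int) : prime p -> (5 <= p)%N ->
  (s <= r)%N ->
  ((p ^ s)%N%:Z %| p%:Z * B)%Z -> ((p ^ r)%N%:Z %| p%:Z * (A - B))%Z ->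
  ratio_mod p (p ^ (r + s + s))%N%:Z 1 (gbinom (p%:Z * A) (p%:Z * B)) (gbinom A B).
Proof.
move=> pp p5 sr pB pAB; have p0 := prime_gt0 pp.
have psr : ((p ^ s)%N%:Z %| (p ^ r)%N%:Z)%Z by rewrite dvdzE /= dvdn_exp2l.
have pA : ((p ^ s)%N%:Z %| p%:Z * A)%Z.
  by rewrite -[A](subrK B) mulrDr rpredD // (dvdz_trans psr).
have main (A1 B1 : int) : 0 <= B1 -> ((p ^ s)%N%:Z %| p%:Z * A1)%Z ->
    ((p ^ s)%N%:Z %| p%:Z * B1)%Z -> ((p ^ r)%N%:Z %| p%:Z * (A1 - B1))%Z ->
    ratio_mod p (p ^ (r + s + s))%N%:Z 1 (gbinom (p%:Z * A1) (p%:Z * B1)) (gbinom A1 B1).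
  case: B1 => // B1 _ pA1 pB1 pAB1; rewrite -PoszM in pB1 *.
  exists (unit_prod p (p * B1) (p * B1)%N%:Z), (unit_prod p (p * B1) (p%:Z * A1)).
  rewrite coprimez_unit_prod ?dvdn_mulr // gbinom_scale //; split => //; rewrite mul1r.
  apply: dvdz_unit_prod_sub_ge5 => //; [exact: dvdn_mulr | exact: leq_addl |].
  by rewrite addnC expnD [X in (X %| _)%Z]PoszM dvdz_mul // PoszM -mulrBr.
have [B0|B0] := leP 0 B; first exact: main.
have [AB|AB] := ltP (A - B) 0.
  by rewrite !gbinom0 //; [exact: ratio_mod00 | | |]; nia.
have [A0|A0] := leP 0 A.
  by rewrite !gbinom_small //; [exact: ratio_mod00 | | |]; nia.
have [k hk] : exists k : nat, A - B = k by exists (absz (A - B)%R); lia.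
have op : odd p by case: (even_prime pp) => // p2; move: p5; rewrite p2.
have [D [E [cD eD dE]]] : ratio_mod p (p ^ (r + s + s))%N%:Z 1
    (gbinom (p%:Z * - B) (p%:Z * - A)) (gbinom (- B) (- A)).
  apply: main; rewrite ?mulrN ?rpredN //; first by lia.
  by have -> : - B - - A = A - B by ring.
exists D, E; split => //.
(* Used at [q = 1] and [q = p]: as [p] is odd, the signs agree, and so do the factors [A / B], hence
   both quotients of binomials are equal. *)
have refl (q : nat) : odd q -> q%:Z * B * gbinom (q%:Z * A) (q%:Z * B) =
    (-1) ^+ k * (q%:Z * A) * gbinom (q%:Z * - B) (q%:Z * - A).
  move=> oq; have := gbinom_reflect (q%:Z * A) (q * k)%N.
  rewrite exprM -(signr_odd _ q) oq expr1 PoszM -hk => e.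
  rewrite (gbinom_sym (q%:Z * A)) (gbinom_sym (q%:Z * - B)).
  have -> : q%:Z * A - q%:Z * B = q%:Z * (A - B) by ring.
  have -> : q%:Z * - B - q%:Z * - A = q%:Z * (A - B) by ring.
  have -> : q%:Z * - B = q%:Z * (A - B) - q%:Z * A by ring.
  by rewrite -e; ring.
have := refl 1 isT; rewrite !mul1r => e1; have e2 := refl p op.
have pB0 : p%:Z * B != 0 by rewrite mulf_neq0 //; lia.
apply: (mulfI pB0); rewrite mulrA e2 -(mulrA _ _ D) eD.
transitivity (p%:Z * ((-1) ^+ k * A * gbinom (- B) (- A)) * E); first by ring.
by rewrite -e1; ring.
Qed.

(** * Powers of p dividing binomials, and congruences mod 4 for p = 2 *)

Lemma dvdz_cancel_pfactor (p a b : nat) (x y : int) : prime p ->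
  ~~ ((p ^ b.+1)%N%:Z %| y)%Z -> ((p ^ a)%N%:Z %| y * x)%Z ->
  ((p ^ (a - b))%N%:Z %| x)%Z.
Proof.
move=> pp; rewrite !dvdzE /= abszM => py pa.
have y0 : (0 < absz y)%N by rewrite lt0n; apply: contraNneq py => ->; rewrite dvdn0.
have [m cpm ym] := pfactor_coprime pp y0.
have vb : (logn p (absz y) <= b)%N.
  by rewrite leqNgt; apply: contra py => /(dvdn_exp2l p) h; rewrite ym dvdn_mull.
have [ab|ab] := leqP a b; first by rewrite (eqP (_ : a - b == 0)%N) ?expn0 ?dvd1n.
move: pa; rewrite ym -mulnA Gauss_dvdr ?coprimeXl // -{1}(subnK (leq_trans vb (ltnW ab))).
rewrite expnD mulnC dvdn_pmul2l ?expn_gt0 ?prime_gt0 //.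
by apply: dvdn_trans; rewrite dvdn_exp2l // leq_sub2l.
Qed.

(** From [B binom(A, B) = A binom(A-1, B-1)], where cancelling [B] costs at most [p^b]. *)
Lemma dvdz_gbinom (p a b : nat) (A B : int) : prime p ->
  ((p ^ a)%N%:Z %| A)%Z -> ~~ ((p ^ b.+1)%N%:Z %| B)%Z ->
  ((p ^ (a - b))%N%:Z %| gbinom A B)%Z.
Proof.
move=> pp pA pB; apply: dvdz_cancel_pfactor pp pB _.
by rewrite mul_gbinom_diag dvdz_mulr.
Qed.

Lemma unit_prod2_even (B : nat) (A : int) : (2 %| A - B%:Z)%Z ->
  (4 %| unit_prod 2 (2 * B) (2 * A) - unit_prod 2 (2 * B) (2 * B)%N%:Z)%Z.
Proof.
move=> AB; apply: dvdz_sub_prod => i _.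
have -> : 2 * A - i%:Z - ((2 * B)%N%:Z - i%:Z) = 2 * (A - B%:Z) by rewrite PoszM; ring.
exact: (@dvdz_mul 2 2).
Qed.

(** Each of the [B] odd indices gives one sign: [2A - i] and [-(2B - i)] differ by [2 (A + B - i)],
    where [A + B] and [i] are odd. *)
Lemma unit_prod2_odd (B : nat) (A : int) : ~~ (2 %| A - B%:Z)%Z ->
  (4 %| unit_prod 2 (2 * B) (2 * A) - (-1) ^+ B * unit_prod 2 (2 * B) (2 * B)%N%:Z)%Z.
Proof.
move=> AB.
have -> : (-1) ^+ B = \prod_(0 <= i < 2 * B | ~~ (2 %| i)%N) (-1) :> int.
  elim: B {AB} => [|B IH]; first by rewrite big_nil.
  rewrite (@big_cat_nat _ _ _ (2 * B)) //=; last by rewrite leq_mul2l leqnSn.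
  rewrite -IH exprS mulrC; congr (_ * _).
  rewrite -{1}[(2 * B)%N]add0n big_addn mulnS addnK.
  rewrite (eq_bigl (fun i => ~~ (2 %| i)%N)); last by move=> i; rewrite dvdn_addl ?dvdn_mulr.
  by rewrite big_mkcond !big_nat_recr //= big_nil.
rewrite -big_split /=; apply: dvdz_sub_prod => i i2.
have -> : 2 * A - i%:Z - -1 * ((2 * B)%N%:Z - i%:Z) = 2 * (A + B%:Z - i%:Z) by rewrite PoszM; ring.
apply: (@dvdz_mul 2 2) => //; lia.
Qed.

Lemma gbinom_scale2_ratio (A B : int) : (2 %| A)%Z -> ~~ (2 %| B)%Z ->
  ratio_mod 2 4 (-1) (gbinom (2 * A) (2 * B)) (gbinom A B).
Proof.
move=> eA oB; apply: (@gbinom_scale_ratio 2) => // B' hB'.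
have oB' : odd B' by lia.
have AB : ~~ (2 %| A - B'%:Z)%Z by lia.
by have := unit_prod2_odd _ _ AB; rewrite -signr_odd oB' expr1.
Qed.

(** The sign -1 arises only for an odd lower entry and an even [A]; then [gbinom A B'] is even and
    the sign is invisible mod 4. *)
Lemma gbinom_scale2 (A B : int) : (4 %| gbinom (2 * A) (2 * B) - gbinom A B)%Z.
Proof.
have main (B' : nat) : (4 %| gbinom (2 * A) (2 * B'%:Z) - gbinom A B'%:Z)%Z.
  have e := @gbinom_scale 2 B' A isT; have cD := @coprimez_unit_prod 2 (2 * B') isT (dvdn_mulr _ _).
  move: e (cD (dvdnn 2)) => {cD}; set D := unit_prod _ _ (Posz _) => e cD.
  have c4 : coprimez 4 D by exact: (coprimezXl 2%N cD).
  rewrite -(Gauss_dvdzl _ c4) mulrBl PoszM in e *; rewrite e.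
  have [eAB|oAB] := boolP (2 %| A - B'%:Z)%Z.
    by rewrite -mulrBr dvdz_mull // unit_prod2_even.
  have := unit_prod2_odd _ _ oAB; rewrite -/D -signr_odd.
  case: (boolP (odd B')) => oB' /=; last by rewrite mul1r -mulrBr; exact: dvdz_mull.
  rewrite expr1 mulN1r opprK => h.
  have e2 : (2 %| gbinom A B')%Z.
    by have := @dvdz_gbinom 2 1 0 A B' isT; rewrite subn0; apply; lia.
  have -> : gbinom A B' * unit_prod 2 (2 * B') (2 * A) - gbinom A B' * D =
    gbinom A B' * (unit_prod 2 (2 * B') (2 * A) + D) - 2 * gbinom A B' * D by ring.
  by apply: rpredB; [exact: dvdz_mull | apply: dvdz_mulr; exact: (@dvdz_mul 2 2)].
have [B0|B0] := leP 0 B.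
  by have [B' ->] : exists B' : nat, B = B' by [exists (absz B); lia|].
have [AB|AB] := leP B A; last by rewrite !gbinom0 ?subrr //; lia.
have [B' hB] : exists B' : nat, A - B = B' by exists (absz (A - B)%R); lia.
by rewrite gbinom_sym (gbinom_sym A) -mulrBr hB.
Qed.

(** * Terms with index divisible by p *)

Lemma gbinom_scale_dvdz_sqr (p s : nat) (A B : int) : prime p -> (0 < s)%N ->
  ((p ^ s)%N%:Z %| p%:Z * A)%Z -> ((p ^ s)%N%:Z %| p%:Z * B)%Z ->
  ((p ^ (s + s))%N%:Z %| gbinom (p%:Z * A) (p%:Z * B) - gbinom A B)%Z.
Proof.
move=> pp s0 pA pB; have [/orP ops|] := boolP (odd p || (1 < s)%N).
  apply: (ratio_mod_dvdz p (s + s) 0) => //.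
  by apply: gbinom_scale_ratio_sqr => //; apply/orP.
rewrite negb_or -leqNgt => /andP[op s1]; have p2 : p = 2%N by case: (even_prime pp) op => // ->.
have s1' : s = 1%N by lia.
by rewrite p2 s1'; exact: gbinom_scale2.
Qed.

Definition multinom_factor (b : seq int) (k : int) (i : nat) : int :=
  gbinom (\sum_(t < i.+1) b`_t - i%:Z * k) (b`_i - k).

(** The omitted factor [i = 0] equals [gbinom b_0 k]; it is kept apart because its divisibility by
    powers of [p] is used. *)
Definition multinom_tail (b : seq int) (k : int) : int :=
  \prod_(1 <= i < size b) multinom_factor b k i.

Lemma multinomE (b : seq int) (k : int) : (0 < size b)%N ->
  multinom b k = gbinom b`_0 k * multinom_tail b k.
Proof.
move=> b0; rewrite /multinom -(big_mkord xpredT (multinom_factor b k)) big_ltn //; congr (_ * _).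
by rewrite /multinom_factor big_ord1 mul0r subr0 [RHS]gbinom_sym.
Qed.

Lemma nth_scalev (m : nat) (n : seq int) (i : nat) : (scalev m n)`_i = m%:Z * n`_i.
Proof.
have [ni|ni] := ltnP i (size n); first by rewrite (nth_map 0) // mulrC.
by rewrite !nth_default ?mulr0 // size_map.
Qed.

Lemma scalev_mul (a b : nat) (n : seq int) : scalev (a * b) n = scalev a (scalev b n).
Proof.
by rewrite /scalev -map_comp; apply: eq_map => x /=; rewrite PoszM (mulrC a%:Z) mulrA.
Qed.

Lemma block_scalev (lam : seq nat) (m : nat) (n : seq int) (j : nat) :
  block lam (scalev m n) j = scalev m (block lam n j).
Proof. by rewrite /block /scalev map_take map_drop. Qed.

Lemma size_block (lam : seq nat) (n : seq int) (j : nat) :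
  size n = sumn lam -> (j < size lam)%N -> size (block lam n j) = nth 0%N lam j.
Proof.
move=> sn jl; have : (sumn (take j.+1 lam) + sumn (drop j.+1 lam) = size n)%N.
  by rewrite -sumn_cat cat_take_drop.
rewrite (take_nth 0%N) // sumn_rcons => e.
by rewrite /block size_take size_drop /sfun; case: ltnP; lia.
Qed.

Lemma dvdz_nth_block (lam : seq nat) (n : seq int) (d : int) (j i : nat) :
  (forall i, (d %| n`_i)%Z) -> (d %| (block lam n j)`_i)%Z.
Proof.
move=> dn; rewrite /block; have [ij|ij] := ltnP i (nth 0%N lam j).
  by rewrite nth_take // nth_drop.
by rewrite nth_default ?dvdz0 // size_take; case: ltnP; lia.
Qed.

Lemma multinom_factor_scale (p : nat) (b : seq int) (k : int) (i : nat) :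
  multinom_factor (scalev p b) (p%:Z * k) i =
  gbinom (p%:Z * (\sum_(t < i.+1) b`_t - i%:Z * k)) (p%:Z * (b`_i - k)).
Proof.
rewrite /multinom_factor nth_scalev !mulrBr mulr_sumr (mulrCA i%:Z).
by under eq_bigr => t _ do rewrite nth_scalev.
Qed.

Lemma multinom_congr (d : int) (p : nat) (b : seq int) (k : int) :
  (forall i, (i < size b)%N ->
    (d %| multinom_factor (scalev p b) (p%:Z * k) i - multinom_factor b k i)%Z) ->
  (d %| multinom (scalev p b) (p%:Z * k) - multinom b k)%Z /\
  (d %| multinom_tail (scalev p b) (p%:Z * k) - multinom_tail b k)%Z.
Proof.
move=> H; rewrite /multinom /multinom_tail size_map.
split; first by apply: dvdz_sub_prod => i _; apply: H.
rewrite big_nat_cond [X in (_ %| _ - X)%Z]big_nat_cond.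
by apply: dvdz_sub_prod => i /andP[/andP[_ ib] _]; apply: H.
Qed.

Lemma multinom_factor_congr_sqr (p s : nat) (b : seq int) (k : int) (i : nat) : prime p ->
  (forall i, ((p ^ s)%N%:Z %| b`_i)%Z) -> ((p ^ s)%N%:Z %| k)%Z ->
  ((p ^ (s.+1 + s.+1))%N%:Z %| multinom_factor (scalev p b) (p%:Z * k) i - multinom_factor b k i)%Z.
Proof.
move=> pp pb pk; rewrite multinom_factor_scale; apply: gbinom_scale_dvdz_sqr => //.
  rewrite expnS PoszM dvdz_mul // rpredB ?dvdz_mull //.
  by apply: dvdz_sum => t _; apply: pb.
by rewrite expnS PoszM dvdz_mul // rpredB.
Qed.

(** For [i = 0] the upper entry is [b_0]; for [i = 1] the upper minus the lower entry is [b_0]. From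
    [i = 2] on both involve [k]. *)
Lemma multinom_factor_congr_cube (p s r : nat) (b : seq int) (k : int) (i : nat) : prime p ->
  (5 <= p)%N -> (s <= r)%N -> (i <= 1)%N ->
  (forall i, ((p ^ r)%N%:Z %| b`_i)%Z) -> ((p ^ s)%N%:Z %| k)%Z ->
  ((p ^ (r.+1 + s.+1 + s.+1))%N%:Z %| multinom_factor (scalev p b) (p%:Z * k) i - multinom_factor b k i)%Z.
Proof.
move=> pp p5 sr i1 pb pk; rewrite multinom_factor_scale.
apply: (ratio_mod_dvdz p (r.+1 + s.+1 + s.+1) 0) => //.
have psb j : ((p ^ s)%N%:Z %| b`_j)%Z.
  by apply: dvdz_trans (pb j); rewrite dvdzE /= dvdn_exp2l.
case: i i1 => [|[|//]] _; rewrite /multinom_factor.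
  rewrite big_ord1 mul0r subr0; apply: gbinom_scale_ratio_cube => //.
    by rewrite expnS PoszM dvdz_mul.
  by rewrite expnS PoszM dvdz_mul // rpredB.
apply: gbinom_scale_ratio_cube_sub => //.
  by rewrite expnS PoszM dvdz_mul // rpredB.
rewrite expnS PoszM dvdz_mul // !big_ord_recl big_ord0 /= mul1r.
by rewrite (_ : _ - _ = b`_0) //; ring.
Qed.

Definition Alam_tail (lam : seq nat) (n : seq int) (k : int) : int :=
  multinom_tail (block lam n 0) k * multinom_tail (block lam n 1) k *
  \prod_(2 <= j < size lam) multinom (block lam n j) k.

Lemma AlamE (lam : seq nat) (n : seq int) (k : int) : (1 < size lam)%N ->
  (forall j, (j < size lam)%N -> (0 < size (block lam n j))%N) ->
  Alam lam n k = gbinom (block lam n 0)`_0 k * gbinom (block lam n 1)`_0 k * Alam_tail lam n k.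
Proof.
move=> l2 bl; rewrite /Alam -(big_mkord xpredT (fun j => multinom (block lam n j) k)).
have l0 : (0 < size lam)%N by exact: ltnW.
by rewrite (big_ltn l0) (big_ltn l2) !multinomE ?bl // /Alam_tail; ring.
Qed.

Lemma Alam_tail_congr (d : int) (p : nat) (lam : seq nat) (n : seq int) (k : int) :
  (1 < size lam)%N ->
  (forall j i, (j < size lam)%N -> (i < size (block lam n j))%N ->
    (d %| multinom_factor (scalev p (block lam n j)) (p%:Z * k) i - multinom_factor (block lam n j) k i)%Z) ->
  (d %| Alam_tail lam (scalev p n) (p%:Z * k) - Alam_tail lam n k)%Z.
Proof.
move=> l2 H; rewrite /Alam_tail !block_scalev; apply: dvdz_subM.
  apply: dvdz_subM.
    by case: (multinom_congr d p (block lam n 0) k) => // i; apply: H; lia.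
  by case: (multinom_congr d p (block lam n 1) k) => // i; apply: H; lia.
rewrite big_nat_cond [X in (_ %| _ - X)%Z]big_nat_cond.
apply: dvdz_sub_prod => j /andP[/andP[_ jl] _]; rewrite block_scalev.
by case: (multinom_congr d p (block lam n j) k) => // i; apply: H.
Qed.

(** The two ratios multiply to [c^2 = 1] mod [p^t], and [y0 * y1] contributes [p^(2u)] to both error
    terms. *)
Lemma mul_congr_ratio (p t u : nat) (c x0 y0 x1 y1 R R' : int) : prime p -> c * c = 1 ->
  ratio_mod p (p ^ t)%N%:Z c x0 y0 -> ratio_mod p (p ^ t)%N%:Z c x1 y1 ->
  ((p ^ u)%N%:Z %| y0)%Z -> ((p ^ u)%N%:Z %| y1)%Z -> ((p ^ t)%N%:Z %| R - R')%Z ->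
  ((p ^ (u + u + t))%N%:Z %| x0 * x1 * R - y0 * y1 * R')%Z.
Proof.
move=> pp cc h0 h1 u0 u1 RR.
have := ratio_mod_mul _ _ _ _ _ _ _ _ h0 h1; rewrite cc => h.
have y01 : ((p ^ (u + u))%N%:Z %| y0 * y1)%Z by rewrite expnD PoszM dvdz_mul.
have -> : x0 * x1 * R - y0 * y1 * R' = (x0 * x1 - y0 * y1) * R + y0 * y1 * (R - R') by ring.
apply: rpredD; first by apply: dvdz_mulr; apply: ratio_mod_dvdz.
by rewrite expnD PoszM dvdz_mul.
Qed.

(* [s] is the valuation of [k], cut off at [r]. *)
Lemma pvaluation_cut (p r : nat) (k : int) :
  exists s : nat, [/\ (s <= r)%N, ((p ^ s)%N%:Z %| k)%Z &
    (s < r)%N -> ~~ ((p ^ s.+1)%N%:Z %| k)%Z].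
Proof.
elim: r => [|r [s [sr ps ns]]]; first by exists 0%N; rewrite expn0 dvd1z.
have [pr|npr] := boolP ((p ^ r.+1)%N%:Z %| k)%Z; first by exists r.+1; rewrite pr ltnn.
exists s; split=> [|//|_]; first lia.
by move: sr; rewrite leq_eqVlt => /orP[/eqP -> //|/ns].
Qed.

(** [n] is already divisible by [p^r], so [r + 1] is the exponent of the theorem. Factorwise
    congruences give [p^(2(s+1))]; if [s < r], two first binomials supply [p^(r-s)] each. *)
Lemma Alam_congr_sqr (p r : nat) (lam : seq nat) (n : seq int) (k : int) : prime p ->
  (1 < size lam)%N -> (forall j, (j < size lam)%N -> (0 < size (block lam n j))%N) ->
  (forall i, ((p ^ r)%N%:Z %| n`_i)%Z) ->
  ((p ^ (2 * r.+1))%N%:Z %| Alam lam (scalev p n) (p%:Z * k) - Alam lam n k)%Z.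
Proof.
move=> pp l2 bl pn; have [s [sr pk nk]] := pvaluation_cut p r k.
have psn i : ((p ^ s)%N%:Z %| n`_i)%Z.
  by apply: dvdz_trans (pn i); rewrite dvdzE /= dvdn_exp2l.
have psb j i := dvdz_nth_block lam n _ j i psn.
have pb j i := dvdz_nth_block lam n _ j i pn.
have fc j i : ((p ^ (s.+1 + s.+1))%N%:Z %|
    multinom_factor (scalev p (block lam n j)) (p%:Z * k) i - multinom_factor (block lam n j) k i)%Z.
  by apply: multinom_factor_congr_sqr.
move: sr; rewrite leq_eqVlt => /orP[/eqP sr|sr].
  rewrite mul2n -addnn -{1 2}sr /Alam; apply: dvdz_sub_prod => j _; rewrite block_scalev.
  by case: (multinom_congr _ p (block lam n j) k (fun i _ => fc j i)).
have blp j : (j < size lam)%N -> (0 < size (block lam (scalev p n) j))%N.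
  by move=> jl; rewrite block_scalev size_map bl.
rewrite !AlamE // (_ : 2 * r.+1 = (r - s) + (r - s) + (s.+1 + s.+1))%N; last lia.
have [c [cc hc]] : exists c : int, c * c = 1 /\ forall j, ratio_mod p (p ^ (s.+1 + s.+1))%N%:Z c
    (gbinom (block lam (scalev p n) j)`_0 (p%:Z * k)) (gbinom (block lam n j)`_0 k).
  have [ops|] := boolP (odd p || (0 < s)%N).
    exists 1; split => // j; rewrite block_scalev nth_scalev.
    by apply: gbinom_scale_ratio_sqr => //; rewrite expnS PoszM dvdz_mul.
  rewrite negb_or -leqNgt leqn0 => /andP[op /eqP s0].
  have p2 : p = 2%N by case: (even_prime pp) op => // ->.
  (* The two signs cancel in the product. *)
  exists (-1); split => // j; rewrite block_scalev nth_scalev p2 s0.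
  apply: gbinom_scale2_ratio; last by have := nk sr; rewrite p2 s0 expn1.
  by apply: dvdz_trans (pb j 0); rewrite p2 dvdzE /= dvdn_exp //; lia.
apply: mul_congr_ratio (pp) cc (hc 0%N) (hc 1%N) _ _ _; try exact: (dvdz_gbinom _ _ _ _ _ pp (pb _ _) (nk sr)).
by apply: Alam_tail_congr.
Qed.

(** The same scheme, with factorwise modulus [p^((r+1) + 2(s+1))]. *)
Lemma Alam_congr_cube (p r : nat) (lam : seq nat) (n : seq int) (k : int) : prime p ->
  (5 <= p)%N ->
  (1 < size lam)%N -> (forall j, (j < size lam)%N -> (0 < size (block lam n j) <= 2)%N) ->
  (forall i, ((p ^ r)%N%:Z %| n`_i)%Z) ->
  ((p ^ (3 * r.+1))%N%:Z %| Alam lam (scalev p n) (p%:Z * k) - Alam lam n k)%Z.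
Proof.
move=> pp p5 l2 bl pn; have [s [sr pk nk]] := pvaluation_cut p r k.
have pb j i := dvdz_nth_block lam n _ j i pn.
have fc j i : (j < size lam)%N -> (i < size (block lam n j))%N -> ((p ^ (r.+1 + s.+1 + s.+1))%N%:Z %|
    multinom_factor (scalev p (block lam n j)) (p%:Z * k) i - multinom_factor (block lam n j) k i)%Z.
  by move=> /bl jl ib; apply: multinom_factor_congr_cube => //; lia.
move: sr; rewrite leq_eqVlt => /orP[/eqP sr|sr].
  rewrite (_ : 3 * r.+1 = r.+1 + s.+1 + s.+1)%N; last lia.
  rewrite /Alam; apply: dvdz_sub_prod => j _; rewrite block_scalev.
  by case: (multinom_congr _ p (block lam n j) k (fun i => fc j i (ltn_ord j))).
have bl0 j : (j < size lam)%N -> (0 < size (block lam n j))%N by move=> /bl/andP[].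
have blp j : (j < size lam)%N -> (0 < size (block lam (scalev p n) j))%N.
  by move=> jl; rewrite block_scalev size_map bl0.
rewrite !AlamE // (_ : 3 * r.+1 = (r - s) + (r - s) + (r.+1 + s.+1 + s.+1))%N; last lia.
have hc j : ratio_mod p (p ^ (r.+1 + s.+1 + s.+1))%N%:Z 1
    (gbinom (block lam (scalev p n) j)`_0 (p%:Z * k)) (gbinom (block lam n j)`_0 k).
  rewrite block_scalev nth_scalev.
  by apply: gbinom_scale_ratio_cube; rewrite ?expnS ?[X in (X %| _)%Z]PoszM ?dvdz_mul //; lia.
apply: mul_congr_ratio (pp) (mulr1 1) (hc 0%N) (hc 1%N) _ _ _; try exact: (dvdz_gbinom _ _ _ _ _ pp (pb _ _) (nk sr)).
by apply: Alam_tail_congr.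
Qed.

(** * Terms with index prime to p *)

Lemma dvdz_Alam (p r : nat) (lam : seq nat) (n : seq int) (k : int) : prime p ->
  (forall j, (j < size lam)%N -> (0 < size (block lam n j))%N) ->
  (forall i, ((p ^ r)%N%:Z %| n`_i)%Z) -> ~~ (p%:Z %| k)%Z ->
  ((p ^ (r * size lam))%N%:Z %| Alam lam n k)%Z.
Proof.
move=> pp bl pn pk; rewrite expnM /Alam.
have -> : ((p ^ r) ^ size lam)%N%:Z = \prod_(j < size lam) (p ^ r)%N%:Z.
  rewrite prodr_const card_ord; elim: (size lam) => [|m IH]; first by rewrite expr0.
  by rewrite exprS expnS PoszM IH.
apply: (big_rec2 (fun x y => x %| y)%Z) => // j x y _; apply: dvdz_mul.
rewrite multinomE ?bl // dvdz_mulr // -[r]subn0.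
by apply: (dvdz_gbinom _ _ _ _ _ pp); [exact: dvdz_nth_block | rewrite expn1].
Qed.

(** What remains of [multinom b k] without the factor [b_0 / k]; up to a constant, [G] of the
    overview is a product of two of these. *)
Definition block_quot (b : seq int) (k : int) : int :=
  gbinom (b`_0 - 1) (k - 1) * multinom_tail b k.

Lemma mul_multinom (b : seq int) (k : int) : (0 < size b)%N ->
  k * multinom b k = b`_0 * block_quot b k.
Proof. by move=> b0; rewrite multinomE // mulrA mul_gbinom_diag mulrA. Qed.

(** Modulo the entries of [b], [k] times the first binomial changes sign under [k -> k + 1] and [k]
    times the tail is unchanged; cancelling [k] costs [p^v]. *)
Lemma block_quot_step (p r v : nat) (b : seq int) (k : int) : prime p ->
  (0 < size b <= 2)%N -> (forall i, ((p ^ r)%N%:Z %| b`_i)%Z) ->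
  ~~ ((p ^ v.+1)%N%:Z %| k)%Z ->
  ((p ^ (r - v))%N%:Z %| block_quot b (k + 1) - - block_quot b k)%Z.
Proof.
move=> pp sb pb pk; rewrite /block_quot addrK -mulNr; apply: dvdz_subM.
  apply: dvdz_cancel_pfactor pp pk _; rewrite mulrBr mul_gbinom_down mulrN opprK -mulrDl.
  by rewrite dvdz_mulr //; have -> : b`_0 - 1 - k + 1 + k = b`_0 by ring.
rewrite /multinom_tail; case: b sb pb => [|b0 [|b1 [|//]]] //= _ pb.
  by rewrite !big_geq // subrr dvdz0.
(* By symmetry the lower entry does not depend on [l]. *)
have e l : multinom_factor [:: b0; b1] l 1 = gbinom (b0 + b1 - l) b0.
  rewrite /multinom_factor !big_ord_recl big_ord0 /= mul1r addr0 gbinom_sym.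
  by congr gbinom; ring.
rewrite !big_nat1 !e.
apply: dvdz_cancel_pfactor pp pk _.
have := mul_gbinom_left (b0 + b1 - k) b0.
have -> : b0 + b1 - k - 1 = b0 + b1 - (k + 1) by ring.
set x := gbinom _ _; set y := gbinom _ _ => xy.
have -> : k * (x - y) = (b0 + b1) * x - b1 * y - ((b0 + b1 - k) * x - (b0 + b1 - k - b0) * y).
  by ring.
rewrite xy subrr subr0 rpredB ?dvdz_mulr ?rpredD //.
- exact: (pb 0%N).
- exact: (pb 1%N).
- exact: (pb 1%N).
Qed.

(* Going from length [p ^ j] to [p ^ j.+1], on each subblock [G] may be replaced by
   a single value, whose error mod [p ^ (r - j)] meets a weight divisible by [p ^ j]. *)
Lemma dvdz_sum_block (p r : nat) (W G : int -> int) : prime p ->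
  (forall k, (p%:Z %| k)%Z -> W k = 0) ->
  (forall j c, (j <= r)%N -> ((p ^ j)%N%:Z %| c)%Z ->
    ((p ^ j)%N%:Z %| \sum_(0 <= i < p ^ j) W (c + i%:Z))%Z) ->
  (forall v k, (v < r)%N -> ~~ ((p ^ v.+1)%N%:Z %| k)%Z ->
    ((p ^ (r - v))%N%:Z %| G (k + 1) - G k)%Z) ->
  forall c, (0 < r)%N -> ((p ^ r)%N%:Z %| c)%Z ->
    ((p ^ r)%N%:Z %| \sum_(0 <= i < p ^ r) W (c + i%:Z) * G (c + i%:Z))%Z.
Proof.
move=> pp W0 WS GS c r0 rc; have p0 := prime_gt0 pp; have p1 := prime_gt1 pp.
(* Strictly inside a block of length [p^(v+1)] starting at a multiple of it, valuations are at most
   [v], so [G] is constant mod [p^(r-v)]. The base point is [c' + 1], as [c'] may have larger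
   valuation. *)
have chain v c' : (v < r)%N -> ((p ^ v.+1)%N%:Z %| c')%Z -> forall i, (i.+1 < p ^ v.+1)%N ->
    ((p ^ (r - v))%N%:Z %| G (c' + i.+1%:Z) - G (c' + 1))%Z.
  move=> vr vc; elim=> [|i IH] iv; first by rewrite subrr dvdz0.
  have iv' : (i.+1 < p ^ v.+1)%N by lia.
  rewrite -[X in (_ %| X)%Z](subrKA (G (c' + i.+1%:Z))) rpredD ?IH //.
  have -> : c' + i.+2%:Z = c' + i.+1%:Z + 1 by lia.
  apply: GS => //; rewrite rpredDl // dvdzE /=.
  by apply/negP => /dvdn_leq => /(_ isT); lia.
suff H j : (j < r)%N -> forall c', ((p ^ j.+1)%N%:Z %| c')%Z ->
    ((p ^ r)%N%:Z %| \sum_(0 <= i < p ^ j.+1) W (c' + i%:Z) * (G (c' + i%:Z) - G (c' + 1)))%Z.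
  have rr : (r.-1 < r)%N by lia.
  have := H _ rr c; rewrite prednK // => /(_ rc) h.
  have -> : \sum_(0 <= i < p ^ r) W (c + i%:Z) * G (c + i%:Z) =
     \sum_(0 <= i < p ^ r) W (c + i%:Z) * (G (c + i%:Z) - G (c + 1)) +
     (\sum_(0 <= i < p ^ r) W (c + i%:Z)) * G (c + 1).
    by rewrite mulr_suml -big_split; apply: eq_bigr => i _ /=; ring.
  by rewrite rpredD // dvdz_mulr // WS.
elim: j => [|j IH] jr c' jc.
  (* At offset 0 the weight vanishes; elsewhere [chain] with [v = 0] gives [p^r]. *)
  rewrite expn1 in jc *; rewrite big_nat_cond; apply: dvdz_sum => -[|i] /andP[/andP[_ ip] _].
    by rewrite W0 ?mul0r ?dvdz0 // addr0.
  by rewrite dvdz_mull // -{1}[r]subn0 chain ?expn1.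
have pj : ((p ^ j.+1)%N%:Z %| c')%Z by apply: dvdz_trans jc; rewrite dvdzE /= dvdn_exp2l.
rewrite expnS big_nat_mul big_nat_cond; apply: dvdz_sum => t /andP[/andP[_ tp] _].
rewrite -{1}[(t * _)%N]add0n big_addn mulSn addnK.
set d := c' + (t * p ^ j.+1)%N%:Z.
have dj : ((p ^ j.+1)%N%:Z %| d)%Z by rewrite rpredD // dvdzE /= dvdn_mull.
have -> : \sum_(0 <= i < p ^ j.+1) W (c' + (i + t * p ^ j.+1)%N%:Z) *
    (G (c' + (i + t * p ^ j.+1)%N%:Z) - G (c' + 1)) =
    \sum_(0 <= i < p ^ j.+1) W (d + i%:Z) * (G (d + i%:Z) - G (d + 1)) +
    (\sum_(0 <= i < p ^ j.+1) W (d + i%:Z)) * (G (d + 1) - G (c' + 1)).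
  rewrite mulr_suml -big_split; apply: eq_bigr => i _ /=.
  have -> : c' + (i + t * p ^ j.+1)%N%:Z = d + i%:Z by rewrite /d PoszD; ring.
  by ring.
rewrite rpredD //; first by apply: IH => //; lia.
(* The weights give [p^(j+1)]; the change of base point gives the rest by [chain] with
   [v = j + 1]. *)
rewrite (_ : p ^ r = p ^ j.+1 * p ^ (r - j.+1))%N; last by rewrite -expnD subnKC // ltnW.
rewrite PoszM dvdz_mul ?WS //; first by lia.
have -> : d + 1 = c' + (t * p ^ j.+1).+1%:Z by rewrite /d; lia.
apply: chain => //.
have : (t.+1 * p ^ j.+1 <= p ^ j.+2)%N by rewrite (expnS p j.+1) leq_mul2r tp orbT.
have : (p ^ 1 <= p ^ j.+1)%N by rewrite leq_exp2l.
rewrite expn1 mulSn; lia.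
Qed.

(** Represents [eps^k / k^2] mod [p^r], set to 0 at multiples of [p] so that sums may run over whole
    blocks. *)
Definition inv_sqr_weight (p r : nat) (eps k : int) : int :=
  if (p%:Z %| k)%Z then 0 else eps ^ k * invz_mod (k * k) (p ^ r)%N%:Z.

(** As [p^j] divides [c], [c + i] may be replaced by [i] in the inverse squares, and [eps^c] factors
    out. *)
Lemma dvdz_sum_inv_sqr_weight (p r j : nat) (eps c : int) : prime p -> (5 <= p)%N ->
  eps = 1 \/ eps = -1 -> (j <= r)%N -> ((p ^ j)%N%:Z %| c)%Z ->
  ((p ^ j)%N%:Z %| \sum_(0 <= i < p ^ j) inv_sqr_weight p r eps (c + i%:Z))%Z.
Proof.
move=> pp p5 he jr; case: j jr => [|j] jr pc; first by rewrite expn0 dvd1z.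
have ue : eps \is a GRing.unit by case: he => ->; rewrite ?unitrN unitr1.
have ppc : (p%:Z %| c)%Z by apply: dvdz_trans pc; rewrite dvdzE /= dvdn_exp.
have pi (i : nat) : (p%:Z %| c + i%:Z)%Z = (p %| i)%N by rewrite rpredDl.
pose w i := invz_mod ((c + i%:Z) * (c + i%:Z)) (p ^ r)%N%:Z.
have wP i : ~~ (p %| i)%N -> ((p ^ j.+1)%N%:Z %| w i * (i%:Z * i%:Z) - 1)%Z.
  move=> npi; have : coprimez (p ^ r)%N%:Z ((c + i%:Z) * (c + i%:Z)).
    by rewrite coprimezMr andbb coprimezE coprimeXl // -[coprime _ _]/(coprimez p _) prime_coprimez // pi.
  move=> /invz_modP; rewrite -/(w i) => h.
  have {}h : ((p ^ j.+1)%N%:Z %| w i * ((c + i%:Z) * (c + i%:Z)) - 1)%Z.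
    by apply: dvdz_trans h; rewrite dvdzE /= dvdn_exp2l.
  have -> : w i * (i%:Z * i%:Z) - 1 = w i * ((c + i%:Z) * (c + i%:Z)) - 1 - w i * (c + 2 * i%:Z) * c by ring.
  by rewrite rpredB // dvdz_mull.
have -> : \sum_(0 <= i < p ^ j.+1) inv_sqr_weight p r eps (c + i%:Z) =
    eps ^ c * \sum_(0 <= i < p ^ j.+1 | ~~ (p %| i)%N) eps ^+ i * w i.
  rewrite [X in _ * X]big_mkcond mulr_sumr; apply: eq_bigr => i _.
  rewrite /inv_sqr_weight pi; case: ifP => _ /=; first by rewrite mulr0.
  by rewrite exprzDr // mulrA.
apply: dvdz_mull; case: he => ->.
  apply: dvdz_sum_inv_sqr_block => // i npi; rewrite expr1n mul1r; exact: wP.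
apply: dvdz_sum_alt_inv_sqr => // [|i npi].
  by case: (even_prime pp) => // p2; move: p5; rewrite p2.
by rewrite -mulrA -[X in _ - X]mulr1 -mulrBr dvdz_mull // wP.
Qed.

(** With three or more blocks each term is divisible by [q^3]. With two, [q^2] factors out and a
    weighted sum of [G] mod [q] remains. *)
Lemma dvdz_sum_Aterm_block (p r : nat) (lam : seq nat) (eps : int) (n : seq int) (c : int) :
  prime p -> (5 <= p)%N -> eps = 1 \/ eps = -1 -> (0 < r)%N -> (1 < size lam)%N ->
  (forall j, (j < size lam)%N -> (0 < size (block lam n j) <= 2)%N) ->
  (forall i, ((p ^ r)%N%:Z %| n`_i)%Z) -> ((p ^ r)%N%:Z %| c)%Z ->
  ((p ^ (3 * r))%N%:Z %| \sum_(0 <= i < p ^ r | ~~ (p %| i)%N) Aterm lam eps n (c + i%:Z))%Z.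
Proof.
move=> pp p5 he r0 l2 bl pn pc.
have bl0 j : (j < size lam)%N -> (0 < size (block lam n j))%N by move=> /bl/andP[].
have pi (i : nat) : (p%:Z %| c + i%:Z)%Z = (p %| i)%N.
  by rewrite rpredDl //; apply: dvdz_trans pc; rewrite dvdzE /= dvdn_exp.
have [l3|l3] := ltnP 2 (size lam).
  apply: dvdz_sum => i npi; rewrite /Aterm dvdz_mull //.
  apply: dvdz_trans (dvdz_Alam _ _ _ _ _ pp bl0 pn _); last by rewrite pi.
  by rewrite dvdzE /= dvdn_exp2l // mulnC leq_mul2l l3 orbT.
have l2' : size lam = 2%N by lia.
have pb j i := dvdz_nth_block lam n _ j i pn.
set q := (p ^ r)%N%:Z in pc pn pb *.
have /dvdzP[x0 b0] := pb 0%N 0%N; have /dvdzP[x1 b1] := pb 1%N 0%N.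
pose G k := block_quot (block lam n 0) k * block_quot (block lam n 1) k.
have AG k : k * k * Alam lam n k = q * q * (x0 * x1 * G k).
  rewrite /Alam -(big_mkord xpredT (fun j => multinom (block lam n j) k)) l2'.
  rewrite !big_nat_recr //= big_nil mul1r mulrACA !mul_multinom ?bl0 ?l2' // b0 b1 /G; ring.
have q3 : (p ^ (3 * r))%N%:Z = q * q * q by rewrite -!PoszM -!expnD; congr (_ ^ _)%N%:Z; lia.
pose W := inv_sqr_weight p r eps.
have TW i : ~~ (p %| i)%N ->
   (q * q * q %| Aterm lam eps n (c + i%:Z) - q * q * (x0 * x1) * (W (c + i%:Z) * G (c + i%:Z)))%Z.
  rewrite -pi => npk; set k := c + _ in npk *.
  have ck : coprimez p%:Z (k * k) by rewrite coprimezMr andbb prime_coprimez.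
  have cq : coprimez q (k * k) by rewrite coprimezE coprimeXl.
  rewrite -q3 -(@Gauss_dvdzr _ (k * k)); last by rewrite coprimezE coprimeXl.
  rewrite /Aterm /W /inv_sqr_weight (negbTE npk).
  rewrite mulrBr (mulrCA (k * k)) AG.
  set w := invz_mod _ _.
  have -> : eps ^ k * (q * q * (x0 * x1 * G k)) - k * k * (q * q * (x0 * x1) * (eps ^ k * w * G k))
    = q * q * (- (eps ^ k * x0 * x1 * G k) * (w * (k * k) - 1)) by ring.
  by rewrite q3 dvdz_mul // dvdz_mull // invz_modP.
have SW : \sum_(0 <= i < p ^ r) W (c + i%:Z) * G (c + i%:Z) =
    \sum_(0 <= i < p ^ r | ~~ (p %| i)%N) W (c + i%:Z) * G (c + i%:Z).
  rewrite (bigID (fun i => (p %| i)%N)) /= big1 ?add0r // => i.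
  by rewrite -pi /W /inv_sqr_weight => ->; rewrite mul0r.
rewrite q3 (_ : \sum_(0 <= i < _ | _) _ =
  \sum_(0 <= i < p ^ r | ~~ (p %| i)%N)
    (Aterm lam eps n (c + i%:Z) - q * q * (x0 * x1) * (W (c + i%:Z) * G (c + i%:Z))) +
  q * q * ((x0 * x1) * \sum_(0 <= i < p ^ r) W (c + i%:Z) * G (c + i%:Z))); last first.
  by rewrite SW sumrB -mulr_sumr; ring.
rewrite rpredD //; first by apply: dvdz_sum => i; exact: TW.
rewrite dvdz_mul // dvdz_mull //; apply: dvdz_sum_block => //.
- by move=> k; rewrite /W /inv_sqr_weight => ->.
- by move=> j d jr pd; apply: dvdz_sum_inv_sqr_weight.
- move=> v k vr npk; rewrite /G.
  (* Both block quotients change sign, so their product does not. *)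
  rewrite -[X in (_ %| _ - X)%Z]mulrNN; apply: dvdz_subM; apply: block_quot_step => //.
    by apply: bl; lia.
  by apply: bl; lia.
Qed.

(** * Comparison of the full sums *)

Lemma Asum_widen (lam : seq nat) (eps : int) (n : seq int) (s : int) :
  Asum lam eps n s -> exists K : nat, forall N : nat, (K < N)%N ->
    s = \sum_(0 <= i < 2 * N) Aterm lam eps n (i%:Z - N%:Z).
Proof.
move=> [K [K0 ->]]; exists K => N KN.
rewrite -(big_mkord xpredT (fun i => Aterm lam eps n (i%:Z - K%:Z))).
rewrite (@big_cat_nat _ _ _ (N - K) 0 (2 * N)) /=; [|lia|lia].
rewrite [X in _ = X + _]big_nat_cond [X in _ = X + _]big1 ?add0r; last by move=> i /andP[/andP[_ iN] _]; apply: K0; lia.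
rewrite (@big_cat_nat _ _ _ (N + K.+1) (N - K)) /=; [|lia|lia].
rewrite [X in _ = _ + X]big_nat_cond [X in _ = _ + X]big1 ?addr0; last first.
  by move=> i /andP[/andP[Ni _] _]; apply: K0; lia.
rewrite -{1}[(N - K)%N]add0n big_addn (_ : N + K.+1 - (N - K) = K.*2.+1)%N; last lia.
by apply: eq_bigr => i _; congr Aterm; lia.
Qed.

Lemma Aterm_scale_congr (d : int) (p : nat) (lam : seq nat) (eps : int) (n : seq int) (k : int) :
  eps = 1 \/ eps = -1 -> odd p \/ eps = 1 ->
  (d %| Alam lam (scalev p n) (p%:Z * k) - Alam lam n k)%Z ->
  (d %| Aterm lam eps (scalev p n) (p%:Z * k) - Aterm lam eps n k)%Z.
Proof.
move=> he hp h; rewrite /Aterm -exprz_exp.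
have -> : eps ^ p%:Z = eps.
  case: hp => [op|->]; last by rewrite exp1rz.
  by case: he => ->; rewrite ?exp1rz // -exprnP -signr_odd op.
by rewrite -mulrBr dvdz_mull.
Qed.

(** Multiplication by [p] sends the window [[-N, N)] onto the multiples of [p] in [[-pN, pN)]. The
    other indices fall into blocks of length [q], starting at multiples of [q] because [q] divides
    [N]. *)
Lemma Asum_scale_congr (p r : nat) (d : int) (lam : seq nat) (eps : int) (n : seq int)
    (s1 s2 : int) : (0 < p)%N ->
  (forall k, (d %| Aterm lam eps (scalev p n) (p%:Z * k) - Aterm lam eps n k)%Z) ->
  (forall c, ((p ^ r.+1)%N%:Z %| c)%Z ->
    (d %| \sum_(0 <= i < p ^ r.+1 | ~~ (p %| i)%N) Aterm lam eps (scalev p n) (c + i%:Z))%Z) ->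
  Asum lam eps (scalev p n) s1 -> Asum lam eps n s2 -> (d %| s1 - s2)%Z.
Proof.
move=> p0 T0 T1 /Asum_widen[K1 h1] /Asum_widen[K2 h2].
pose q := (p ^ r.+1)%N; have q0 : (0 < q)%N by rewrite expn_gt0 p0.
pose M := (K1 + K2).+1; pose N := (q * M)%N.
have N12 : (K1 + K2 < N)%N by rewrite /N; nia.
rewrite (h1 (p * N)%N) ?(h2 N); [|nia|nia].
rewrite (mulnCA 2) big_nat_mulID // addrAC -sumrB rpredD //.
  apply: dvdz_sum => i _.
  by have -> : (p * i)%N%:Z - (p * N)%N%:Z = p%:Z * (i%:Z - N%:Z) by rewrite !PoszM; ring.
have -> : (p * (2 * N) = (2 * p * M) * q)%N by rewrite /N; ring.
rewrite big_mkcond big_nat_mul; apply: dvdz_sum => t _.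
rewrite -{1}[(t * q)%N]add0n big_addn mulSn addnK.
have pq m : (p %| m * q)%N by rewrite dvdn_mull // dvdn_exp.
under eq_bigr => i _.
  rewrite dvdn_addl //.
  rewrite (_ : (i + t * q)%N%:Z - (p * N)%N%:Z = (t * q)%N%:Z - (p * N)%N%:Z + i%:Z); last by lia.
  over.
rewrite -big_mkcond; apply: T1.
apply: rpredB; rewrite dvdzE /=; first exact: dvdn_mull.
by rewrite /N mulnCA; exact: dvdn_mulr.
Qed.

Theorem theorem3p2 (eps : int) (lam : seq nat) (n : seq int) :
  (eps = 1 \/ eps = -1) ->
  all (fun x => (0 < x)%N) lam ->
  size n = sumn lam ->
  (exists s, Asum lam eps n s) ->
  ((2 <= size lam)%N ->
     forall (p r : nat), prime p -> ((3 <= p)%N \/ eps = 1) -> (0 < r)%N ->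
     forall s1 s2 : int,
       Asum lam eps (scalev (p ^ r) n) s1 ->
       Asum lam eps (scalev (p ^ r.-1) n) s2 ->
       (s1 = s2 %[mod ((p ^ (2 * r))%N)%:Z])%Z)
  /\
  ((2 <= size lam)%N -> all (fun x => (x <= 2)%N) lam ->
     forall (p r : nat), prime p -> (5 <= p)%N -> (0 < r)%N ->
     forall s1 s2 : int,
       Asum lam eps (scalev (p ^ r) n) s1 ->
       Asum lam eps (scalev (p ^ r.-1) n) s2 ->
       (s1 = s2 %[mod ((p ^ (3 * r))%N)%:Z])%Z).
Proof.
move=> he /allP lam0 sn _.
have sb m j : (j < size lam)%N -> size (block lam (scalev m n) j) = nth 0%N lam j.
  by move=> jl; rewrite size_block // size_map.
have bl m j : (j < size lam)%N -> (0 < size (block lam (scalev m n) j))%N.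
  by move=> jl; rewrite sb // lam0 // mem_nth.
have dn m i : (m%:Z %| (scalev m n)`_i)%Z by rewrite nth_scalev dvdz_mulr.
have oddp p : prime p -> (3 <= p)%N -> odd p.
  by move=> pp p3; case: (even_prime pp) => // p2; move: p3; rewrite p2.
split=> [l2 p [//|r] pp hp _ s1 s2|l2 /allP lam2 p [//|r] pp p5 _ s1 s2];
  rewrite expnS scalev_mul /= => h1 h2; apply/eqP; rewrite eqz_mod_dvd.
  apply: (Asum_scale_congr p r) h1 h2 => [|k|c pc]; first exact: prime_gt0.
    apply: Aterm_scale_congr => //; first by case: hp => [/(oddp _ pp)|]; [left|right].
    by apply: Alam_congr_sqr => // j; apply: bl.
  apply: dvdz_sum => i npi; rewrite /Aterm dvdz_mull // -scalev_mul -expnS.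
  apply: dvdz_trans (dvdz_Alam _ _ _ _ _ pp (bl _) (dn _) _).
    by rewrite dvdzE /= dvdn_exp2l // mulnC leq_mul2l l2 orbT.
  by rewrite rpredDl //; apply: dvdz_trans pc; rewrite dvdzE /= dvdn_exp.
have bl2 m j : (j < size lam)%N -> (0 < size (block lam (scalev m n) j) <= 2)%N.
  by move=> jl; rewrite bl // sb // lam2 // mem_nth.
apply: (Asum_scale_congr p r) h1 h2 => [|k|c pc]; first exact: prime_gt0.
  apply: Aterm_scale_congr => //; first by left; apply: oddp => //; apply: ltn_trans p5.
  by apply: Alam_congr_cube => // j; apply: bl2.
rewrite -scalev_mul -expnS; apply: dvdz_sum_Aterm_block => // j; first exact: bl2.
Qed.
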